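(* Let $\tau=2\,\mathrm{Tr}$ on $M_2$. Let $\mathcal{G}^{(1A)}$ and, for $\alpha\in\mathbb{C}$, $\beta\in[0,1]$, let $\mathcal{G}_{\alpha,\beta}^{(1B)}$ be the quantum graphs on $(M_2,\tau)$ with Pauli spaces $$V^{(1A)}=\mathrm{span}\{e_1\}\subset\mathbb{C}^4\quad\text{and}\quad V_{\alpha,\beta}^{(1B)}=\mathrm{span}\{(\alpha,1,i\beta,0)^t\}\subset\mathbb{C}^4,$$ respectively. Let $J^{(1B)}$ be the set of pairs $(\alpha,\beta)\in\mathbb{C}\times[0,1]$ such that $$\beta=1\implies\alpha\in[0,\infty),\qquad\beta\in[0,1)\implies\arg(\alpha)\in[0,\pi).$$ Then any quantum graph on $(M_2,\tau)$ with exactly one quantum edge is isomorphic to either $\mathcal{G}^{(1A)}$ (the trivial quantum graph, with quantum edge space $\mathbb{C}\mathrm{I}_2$) or exactly one of the quantum graphs $\mathcal{G}_{\alpha,\beta}^{(1B)}$ with $(\alpha,\beta)\in J^{(1B)}$.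
   Context: A quantum graph on $(M_2,\tau)$ is given by its quantum edge space, an arbitrary linear subspace $S\subset M_2$; the number of quantum edges is $\dim S$. Two quantum graphs on $(M_2,\tau)$ with edge spaces $S_1,S_2$ are isomorphic if there is a $*$-automorphism $\pi$ of $M_2$ with $\tau\circ\pi=\tau$ and $\pi(S_1)=S_2$. With the Pauli matrices $\sigma_0=\mathrm{I}_2$, $\sigma_1=\begin{pmatrix}0&1\\1&0\end{pmatrix}$, $\sigma_2=\begin{pmatrix}0&-i\\i&0\end{pmatrix}$, $\sigma_3=\begin{pmatrix}1&0\\0&-1\end{pmatrix}$, the Pauli space of the quantum graph with edge space $S$ is $V=\{(x_0,x_1,x_2,x_3)^t\in\mathbb{C}^4: x_0\sigma_0+x_1\sigma_1+x_2\sigma_2+x_3\sigma_3\in S\}$. Convention: $\arg(0)=0$, and $\arg$ takes values in $[0,2\pi)$. *)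

(* Defs.v *)
From HB Require Import structures.
From mathcomp Require Import all_boot all_order all_algebra.
From mathcomp Require Import complex.
From mathcomp Require Import all_classical all_reals all_analysis.
From mathcomp Require Import ring lra.

Set Implicit Arguments.
Unset Strict Implicit.
Unset Printing Implicit Defensive.

Import Order.TTheory GRing.Theory Num.Theory.
Local Open Scope ring_scope.
Local Open Scope complex_scope.
Local Open Scope sesquilinear_scope.

Section QuantumGraph.
Variable R : realType.
Local Notation C := R[i].

(* A quantum graph on M_2 is identified with its quantum edge space.  The
   functional on M_2 only enters through isomorphisms, see qgraph_iso. *)
Definition qgraph := {vspace 'M[C]_2}.

Definition num_qedges (S : qgraph) : nat := \dim S.

Definition is_star_automorphism
    (f : {lrmorphism 'M[C]_2 -> 'M[C]_2}) : Prop :=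
  bijective f /\ forall A : 'M[C]_2, f (A ^t*) = (f A) ^t*.

Definition qgraph_iso (psi : 'M[C]_2 -> C) (S1 S2 : qgraph) : Prop :=
  exists f : {lrmorphism 'M[C]_2 -> 'M[C]_2},
    [/\ is_star_automorphism f,
        forall A, psi (f A) = psi A &
        (linfun f @: S1)%VS = S2].

Definition tau (A : 'M[C]_2) : C := 2 * \tr A.

Definition mx22 (a b c d : C) : 'M[C]_2 :=
  \matrix_(i, j) if i == 0 then if j == 0 then a else b
                 else if j == 0 then c else d.

Definition pauli (k : 'I_4) : 'M[C]_2 :=
  nth 0 [:: mx22 1 0 0 1;
            mx22 0 1 1 0;
            mx22 0 (- 'i%C) 'i%C 0;
            mx22 1 0 0 (- 1)] k.

Definition pauli_comb (x : 'cV[C]_4) : 'M[C]_2 := \sum_k x k 0 *: pauli k.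

Fact pauli_comb_is_linear : linear pauli_comb.
Proof.
move=> a x y; rewrite /pauli_comb scaler_sumr -big_split /=.
by apply: eq_bigr => k _; rewrite !mxE scalerDl scalerA.
Qed.
HB.instance Definition _ :=
  GRing.isLinear.Build C 'cV[C]_4 'M[C]_2 _ pauli_comb pauli_comb_is_linear.

Definition pauli_space (S : qgraph) : {vspace 'cV[C]_4} :=
  (linfun pauli_comb @^-1: S)%VS.

Lemma mem_pauli_space (S : qgraph) (x : 'cV[C]_4) :
  (x \in pauli_space S) = (pauli_comb x \in S).
Proof. by rewrite -memv_preim lfunE. Qed.

(* The value of acos is only meaningful on [-1, 1], where it lies in [0, pi];
   the quotient below always belongs to [-1, 1], see argP. *)
Definition arg (z : C) : R :=
  if z == 0 then 0 else
  let t := acos (complex.Re z / Num.sqrt (complex.Re z ^+ 2 + complex.Im z ^+ 2)) in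
  if 0 <= complex.Im z then t else 2 * pi - t.

Definition vec4 (a b c d : C) : 'cV[C]_4 := \col_k nth 0 [:: a; b; c; d] k.

Definition V1A : {vspace 'cV[C]_4} := <[(vec4 1 0 0 0)%R]>%VS.

Definition V1B (alpha : C) (beta : R) : {vspace 'cV[C]_4} :=
  <[(vec4 alpha 1 ('i%C * beta%:C) 0)%R]>%VS.

(* In the order of R[i], 0 <= alpha means that alpha is real and
   nonnegative. *)
Definition J1B (alpha : C) (beta : R) : Prop :=
  [/\ 0 <= beta <= 1,
      beta = 1 -> 0 <= alpha &
      0 <= beta < 1 -> 0 <= arg alpha < pi].

(* Sanity checks: arg is the argument in [0, 2 pi[, and a quantum graph is
   determined by its Pauli space, every subspace being a Pauli space. *)

Lemma arg0 : arg 0 = 0.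
Proof. by rewrite /arg eqxx. Qed.

Lemma argP (z : C) : z != 0 ->
  let r := Num.sqrt (complex.Re z ^+ 2 + complex.Im z ^+ 2) in
  [/\ 0 <= arg z < 2 * pi,
      complex.Re z = r * cos (arg z) & complex.Im z = r * sin (arg z)].
Proof.
case: z => a b z0 r; rewrite /arg (negPf z0) /=.
have s0 : 0 < a ^+ 2 + b ^+ 2.
  rewrite lt_def addr_ge0 ?sqr_ge0// andbT paddr_eq0 ?sqr_ge0// !sqrf_eq0.
  by move: z0; rewrite eq_complex.
have r0 : 0 < r by rewrite sqrtr_gt0.
have r2 : r ^+ 2 = a ^+ 2 + b ^+ 2 by rewrite sqr_sqrtr// ltW.
have q2 : 1 - (a / r) ^+ 2 = (b / r) ^+ 2.
  by rewrite !expr_div_n r2; field; rewrite lt0r_neq0.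
have q1 : -1 <= a / r <= 1.
  rewrite -ler_norml -(@expr_le1 _ 2)// real_normK ?num_real//.
  by rewrite -subr_ge0 q2 sqr_ge0.
have p0 := pi_gt0 R.
have qi : a / r \in `[-1, 1] by rewrite in_itv.
have := acos_ge0 q1; have := acos_lepi q1.
have rN0 : r != 0 by rewrite gt_eqF.
have E : r * (a / r) = a by rewrite mulrC divfK.
case: ifPn => b0.
  move=> t1 t0; split; first by apply/andP; split; lra.
    by rewrite acosK.
  rewrite sin_acos// q2 sqrtr_sqr ger0_norm ?divr_ge0 ?(ltW r0)//.
  by rewrite mulrC divfK.
move=> t1 t0; have {}b0 : b < 0 by rewrite ltNge.
have t0' : 0 < acos (a / r).
  rewrite acos_gt0//; case/andP: q1 => -> q1 /=; rewrite lt_neqAle q1 andbT.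
  apply/eqP => q; move: q2; rewrite q expr1n subrr => /esym/eqP.
  by rewrite sqrf_eq0 mulf_eq0 invr_eq0 (negPf rN0) orbF lt_eqF.
have e : 2 * pi - acos (a / r) = - acos (a / r) + pi *+ 2.
  by rewrite mulr_natl addrC.
split; first by apply/andP; split; lra.
  by rewrite e cosD2pi cosN acosK.
rewrite e sinD2pi sinN sin_acos// q2 sqrtr_sqr ltr0_norm ?opprK.
  by rewrite mulrC divfK.
by rewrite pmulr_llt0 ?invr_gt0.
Qed.

Definition pauli_coord (A : 'M[C]_2) : 'cV[C]_4 :=
  vec4 ((A 0 0 + A 1 1) / 2) ((A 0 1 + A 1 0) / 2)
       ('i%C * (A 0 1 - A 1 0) / 2) ((A 0 0 - A 1 1) / 2).

Lemma pauli_coordK : cancel pauli_coord pauli_comb.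
Proof.
move=> A; apply/matrixP => i j.
have i2 : ('i%C * 'i%C : C) = -1 by rewrite -expr2 complex.sqr_i.
have n2 : (2 : C) != 0 by rewrite pnatr_eq0.
rewrite /pauli_comb !big_ord_recl big_ord0 !mxE /=.
case: i => -[|[|//]] hi; case: j => -[|[|//]] hj; rewrite /= /eq_op /=.
- have -> : Ordinal hi = 0 by apply/val_inj.
  have -> : Ordinal hj = 0 by apply/val_inj.
  by field.
- have -> : Ordinal hi = 0 by apply/val_inj.
  have -> : Ordinal hj = 1 by apply/val_inj.
  by field: i2.
- have -> : Ordinal hi = 1 by apply/val_inj.
  have -> : Ordinal hj = 0 by apply/val_inj.
  by field: i2.
have -> : Ordinal hi = 1 by apply/val_inj.
have -> : Ordinal hj = 1 by apply/val_inj.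
by field.
Qed.

Lemma pauli_combK : cancel pauli_comb pauli_coord.
Proof.
move=> x; apply/colP => k.
have i2 : ('i%C * 'i%C : C) = -1 by rewrite -expr2 complex.sqr_i.
have n2 : (2 : C) != 0 by rewrite pnatr_eq0.
rewrite /pauli_coord /pauli_comb !big_ord_recl big_ord0 !mxE /=.
case: k => -[|[|[|[|//]]]] hk /=.
- have -> : Ordinal hk = ord0 by apply/val_inj.
  by field: i2.
- have -> : Ordinal hk = lift ord0 ord0 by apply/val_inj.
  by field: i2.
- have -> : Ordinal hk = lift ord0 (lift ord0 ord0) by apply/val_inj.
  by field: i2.
have -> : Ordinal hk = lift ord0 (lift ord0 (lift ord0 ord0)).
  by apply/val_inj.
by field: i2.
Qed.

Lemma pauli_space_bij : bijective pauli_space.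
Proof.
exists (fun V => (linfun pauli_comb @: V)%VS) => [S | V]; apply/vspaceP => y.
  apply/memv_imgP/idP => [[x + ->] | yS].
    by rewrite mem_pauli_space lfunE.
  exists (pauli_coord y); last by rewrite lfunE /= pauli_coordK.
  by rewrite mem_pauli_space pauli_coordK.
rewrite mem_pauli_space; apply/memv_imgP/idP => [[x xV] | yV].
  by rewrite lfunE => /(can_inj pauli_combK) ->.
by exists y => //; rewrite lfunE.
Qed.

End QuantumGraph.

(* Main.v *)
Require Import Defs.
From HB Require Import structures.
From mathcomp Require Import all_boot all_order all_algebra.
From mathcomp Require Import complex.
From mathcomp Require Import all_classical all_reals all_analysis.
From mathcomp Require Import ring.

Set Implicit Arguments.
Unset Strict Implicit.
Unset Printing Implicit Defensive.

(** After a unitary conjugation, any A in M_2 has equal diagonal entries: if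
    diagonalizing the Hermitian commutator [A, A^*] does not already achieve
    this, then A is normal, and a Hadamard-like rotation of its diagonal form
    does.  Conjugating by diagonal unitaries and scaling then moves the
    off-diagonal entries to 1 + beta and 1 - beta with beta in [0, 1], which is
    the matrix alpha I + sigma_1 + i beta sigma_2.  For uniqueness, the numbers
    tr A, tr A^2 and tr A A^* are invariant under tracial *-automorphisms, and
    they determine (alpha, beta) up to the phase of the spanning vector: that
    phase is a sign when beta < 1 and arbitrary when beta = 1. *)

Import Order.TTheory GRing.Theory Num.Theory.
Local Open Scope ring_scope.
Local Open Scope sesquilinear_scope.

Section Mx22.
Variable R : realType.
Local Notation C := R[i].
Implicit Types (a b c d t p q k z : C) (A B U : 'M[C]_2).

(** * Entrywise calculus of two-by-two matrices *)

Lemma mx22_eta A : A = mx22 (A 0 0) (A 0 1) (A 1 0) (A 1 1).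
Proof.
apply/matrixP => i j; rewrite mxE.
case: i => -[|[|//]] ?; case: j => -[|[|//]] ? /=;
  by congr (A _ _); apply: val_inj.
Qed.

Lemma mul_mx22 a b c d a' b' c' d' :
  mx22 a b c d *m mx22 a' b' c' d' =
  mx22 (a * a' + b * c') (a * b' + b * d') (c * a' + d * c') (c * b' + d * d').
Proof.
by rewrite [LHS]mx22_eta; congr mx22; rewrite !mxE !big_ord_recl big_ord0 !mxE
  addr0.
Qed.

Lemma adj_mx22 a b c d : (mx22 a b c d)^t* = mx22 a^* c^* b^* d^*.
Proof. by rewrite [LHS]mx22_eta !mxE. Qed.

Lemma adj_mulmx A B : (A *m B)^t* = B^t* *m A^t*.
Proof. by rewrite trmx_mul map_mxM. Qed.

Lemma scale_mx22 k a b c d :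
  k *: mx22 a b c d = mx22 (k * a) (k * b) (k * c) (k * d).
Proof. by rewrite [LHS]mx22_eta !mxE. Qed.

Lemma scalar_mx22 k : k%:M = mx22 k 0 0 k.
Proof. by rewrite [LHS]mx22_eta !mxE. Qed.

Lemma trace_mx22 a b c d : \tr (mx22 a b c d) = a + d.
Proof. by rewrite /mxtrace !big_ord_recl big_ord0 !mxE addr0. Qed.

Lemma mx22_inj a b c d a' b' c' d' : mx22 a b c d = mx22 a' b' c' d' ->
  [/\ a = a', b = b', c = c' & d = d'].
Proof.
move=> /matrixP E; have := (E 0 0, E 0 1, E 1 0, E 1 1); rewrite !mxE /=.
by move=> [[[]]].
Qed.

Lemma mx22_sub a b c d a' b' c' d' :
  mx22 a b c d - mx22 a' b' c' d' = mx22 (a - a') (b - b') (c - c') (d - d').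
Proof. by rewrite [LHS]mx22_eta !mxE. Qed.

Lemma diag_mx22 (D : 'rV[C]_2) : diag_mx D = mx22 (D 0 0) 0 0 (D 0 1).
Proof. by rewrite [LHS]mx22_eta !mxE. Qed.

Lemma conjC_i : ('i%C : C)^* = - 'i%C.
Proof. by apply/eqP; rewrite eq_complex /= oppr0 !eqxx. Qed.

Lemma sqr_iC : ('i%C * 'i%C : C) = -1.
Proof. by rewrite -expr2 complex.sqr_i. Qed.

Lemma two_neq0 : (2 : C) != 0.
Proof. by rewrite pnatr_eq0. Qed.

Lemma unitarymx1 : (1%:M : 'M[C]_2) \is unitarymx.
Proof. by apply/unitarymxP; rewrite trmx1 map_mx1 mulmx1. Qed.

Lemma unitarymx_mulVmx U : U \is unitarymx -> U^t* *m U = 1%:M.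
Proof. by move=> Uu; rewrite -(invmx_unitary Uu) mulVmx ?unitarymx_unit. Qed.

(** * Unitary conjugation to a constant diagonal *)

Lemma normal_unitary_diag A : A \is normalmx ->
  exists2 U, U \is unitarymx & exists a d, U *m A *m U^t* = mx22 a 0 0 d.
Proof.
move=> An.
have Uu := spectral_unitarymx A.
exists (spectralmx A) => //.
exists (spectral_diag A 0 0), (spectral_diag A 0 1).
have /orthomx_spectralP E := An.
rewrite {2}E -diag_mx22 (invmx_unitary Uu) !mulmxA (unitarymxP Uu) mul1mx.
by rewrite mulmxtVK.
Qed.

(* The off-diagonal entry of the commutator being 0 forces |b| = |c| when the
   diagonal entries of B differ, which makes B normal. *)
Lemma constant_diag A :
  exists2 U, U \is unitarymx & exists t p q, U *m A *m U^t* = mx22 t p q t.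
Proof.
(* The self-commutator is Hermitian, hence unitarily diagonalizable, and it is compatible with
   unitary conjugation. *)
pose commutator B := B *m B^t* - B^t* *m B.
have hK : (commutator A)^t* = commutator A.
  by rewrite /commutator linearB /= map_mxB !adj_mulmx !trmxCK.
have [|P Pu [e [f E]]] := @normal_unitary_diag (commutator A).
  by apply/normalmxP; rewrite hK.
have [B EB] : exists B, B = P *m A *m P^t* by eexists.
have {}E : commutator B = mx22 e 0 0 f.
  rewrite -E /commutator EB !adj_mulmx trmxCK !mulmxA.
  rewrite -!(mulmxA _ (P^t*) P) (unitarymx_mulVmx Pu) !mulmx1.
  by rewrite mulmxBr mulmxBl !mulmxA.
case: (eqVneq (B 0 0) (B 1 1)) => [E01|nE].
  by exists P => //; rewrite -EB [B]mx22_eta E01; do 3 eexists.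
have [e0 f0] : e = 0 /\ f = 0.
  move: E; rewrite /commutator [B]mx22_eta adj_mx22 !mul_mx22 mx22_sub.
  move: nE; move: (B 0 0) (B 0 1) (B 1 0) (B 1 1) => a b c d.
  move=> ad /mx22_inj[<- E1 E2 <-].
  have : `|b| ^+ 2 = `|c| ^+ 2.
    rewrite !normCK.
    have ad' : `|a - d| ^+ 2 != 0 by rewrite sqrf_eq0 normr_eq0 subr_eq0.
    (* [F1] is the vanishing off-diagonal entry and [F2] its conjugate; multiplying them gives |a -
       d|^2 |c|^2 = |a - d|^2 |b|^2. *)
    have F1 : (a - d) * c^* = b * (a - d)^*.
      by rewrite rmorphB /=; apply/eqP; rewrite -subr_eq0 -E1; apply/eqP; ring.
    have F2 : (a - d)^* * c = b^* * (a - d).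
      by rewrite -[c]conjCK -rmorphM F1 rmorphM /= conjCK.
    move: ad'; rewrite normCK => ad'; apply: (mulfI ad').
    have -> : (a - d) * (a - d)^* * (b * b^*) =
              (b * (a - d)^*) * (b^* * (a - d)) by ring.
    by rewrite -F1 -F2; ring.
  by rewrite !normCK => bc; split; ring: bc.
have Bn : B \is normalmx.
  apply/normalmxP/eqP; rewrite -subr_eq0; apply/eqP.
  by rewrite [LHS]E e0 f0 -scalar_mx22 -scalemx1 scale0r.
have [Q Qu [g [h EQ]]] := normal_unitary_diag Bn.
(* A unitary all of whose entries have modulus 1 / sqrt 2 averages the
   diagonal. *)
pose H : 'M[C]_2 := mx22 ((1 + 'i%C) / 2) ((1 - 'i%C) / 2)
                         ((1 - 'i%C) / 2) ((1 + 'i%C) / 2).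
have i2 := sqr_iC; have n2 := two_neq0.
have HE : H^t* = mx22 ((1 - 'i%C) / 2) ((1 + 'i%C) / 2)
                      ((1 + 'i%C) / 2) ((1 - 'i%C) / 2).
  rewrite adj_mx22 !fmorph_div rmorph_nat rmorphB rmorphD /= conjC_i rmorph1.
  by rewrite opprK.
have Hu : H \is unitarymx.
  apply/unitarymxP; rewrite HE mul_mx22 scalar_mx22.
  by congr mx22; field: i2.
exists (H *m Q *m P); first by rewrite !mul_unitarymx.
have -> : H *m Q *m P *m A *m (H *m Q *m P)^t* =
          H *m (Q *m B *m Q^t*) *m H^t*.
  by rewrite EB !adj_mulmx !mulmxA.
rewrite EQ HE !mul_mx22; do 3 eexists.
by congr mx22; field: i2.
Qed.

(** * Unitary equivalence of spanning vectors up to a nonzero scalar *)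

Definition proj_equiv A B := exists U k,
  [/\ U \is unitarymx, k != 0 & U *m A *m U^t* = k *: B].

Lemma proj_equiv_refl A : proj_equiv A A.
Proof.
exists 1%:M, 1; rewrite oner_eq0 scale1r trmx1 map_mx1 mulmx1 mul1mx.
by split=> //; exact: unitarymx1.
Qed.

Lemma proj_equiv_trans A B D :
  proj_equiv A B -> proj_equiv B D -> proj_equiv A D.
Proof.
move=> [U [k [Uu k0 E]]] [V [l [Vu l0 F]]]; exists (V *m U), (k * l).
split; [exact: mul_unitarymx | by rewrite mulf_neq0 | ].
rewrite adj_mulmx !mulmxA -2!(mulmxA V) E.
by rewrite -scalemxAr -scalemxAl F scalerA.
Qed.

(** Conjugation by diag(1, L) rotates the two off-diagonal entries in opposite directions. *)
Lemma proj_equiv_diag (L : C) a b c d : `|L| = 1 ->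
  proj_equiv (mx22 a b c d) (mx22 a (b * L^*) (L * c) d).
Proof.
move=> L1; have LL : L * L^* = 1 by rewrite -normCK L1 expr1n.
exists (mx22 1 0 0 L), 1; split; rewrite ?oner_eq0//.
  by apply/unitarymxP; rewrite adj_mx22 mul_mx22 scalar_mx22 !rmorph1 !rmorph0
    !(mul0r, mulr0, mul1r, addr0, add0r) LL.
rewrite adj_mx22 !mul_mx22 scale1r rmorph1 !rmorph0.
by congr mx22; ring: LL.
Qed.

Lemma proj_equiv_swap a b c d :
  proj_equiv (mx22 a b c d) (mx22 d c b a).
Proof.
exists (mx22 0 1 1 0), 1; split; rewrite ?oner_eq0//.
  by apply/unitarymxP; rewrite adj_mx22 mul_mx22 scalar_mx22 !rmorph1 !rmorph0
    !(mul0r, mulr0, mul1r, addr0, add0r).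
rewrite adj_mx22 !mul_mx22 scale1r rmorph1 !rmorph0.
by congr mx22; ring.
Qed.

Lemma proj_equiv_scale k A : k != 0 -> proj_equiv A (k *: A).
Proof.
move=> k0; exists 1%:M, k^-1; split; rewrite ?invr_eq0//.
  exact: unitarymx1.
by rewrite trmx1 map_mx1 mulmx1 mul1mx scalerA mulVf ?scale1r.
Qed.

(** * Reduction to the normal form *)

Definition mx1B (alpha : C) (beta : R) : 'M[C]_2 :=
  mx22 alpha (1 + beta%:C%C) (1 - beta%:C%C) alpha.

Lemma pauli_comb_1B (alpha : C) (beta : R) :
  pauli_comb (vec4 alpha 1 ('i%C * beta%:C%C) 0) = mx1B alpha beta.
Proof.
have i2 := sqr_iC.
rewrite /pauli_comb !big_ord_recl big_ord0 !mxE /= !scale_mx22 [LHS]mx22_eta.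
by rewrite !mxE /= ; congr mx22; ring: i2.
Qed.

(** Scaling by L and conjugating by diag(1, L) restores the upper off-diagonal entry and multiplies
    the lower one by L^2. This is harmless if L^2 = 1, or if beta = 1, when that entry is 0. *)
Lemma proj_equiv_phase (L alpha : C) (beta : R) :
    `|L| = 1 -> (beta != 1 -> L ^+ 2 = 1) ->
  proj_equiv (mx1B alpha beta) (mx1B (L * alpha) beta).
Proof.
move=> L1 L2.
have LL : L * L^* = 1 by rewrite -normCK L1 expr1n.
have L0 : L != 0 by rewrite -normr_eq0 L1 oner_eq0.
apply: proj_equiv_trans (proj_equiv_scale _ L0) _.
rewrite scale_mx22; apply: proj_equiv_trans (proj_equiv_diag _ _ _ _ L1) _.
suff -> : mx22 (L * alpha) (L * (1 + beta%:C%C) * L^*)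
    (L * (L * (1 - beta%:C%C))) (L * alpha) = mx1B (L * alpha) beta.
  exact: proj_equiv_refl.
congr mx22; first by ring: LL.
have [->|b1] := eqVneq beta 1; first by rewrite subrr !mulr0.
by rewrite mulrA -expr2 L2// mul1r.
Qed.

Lemma phase_decomposition z : exists2 Z, `|Z| = 1 & z = `|z| * Z.
Proof.
have [->|z0] := eqVneq z 0; first by exists 1; rewrite ?normr1// normr0 mul0r.
exists (z / `|z|); last by rewrite mulrC divfK ?normr_eq0.
by rewrite normf_div normr_id divff ?normr_eq0.
Qed.

Lemma proj_equiv_1B_of_le t p q : p != 0 -> `|q| <= `|p| ->
  exists alpha beta,
    0 <= beta <= 1 /\ proj_equiv (mx22 t p q t) (mx1B alpha beta).
Proof.
move=> p0 qp.
have [P P1 Ep] := phase_decomposition p.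
have [Q Q1 Eq] := phase_decomposition q.
(* The modulus is complex-valued; its real part is taken because beta has to lie in [R]. *)
pose x := complex.Re `|p|; pose y := complex.Re `|q|.
have Ex : `|p| = x%:C%C by [].
have Ey : `|q| = y%:C%C by [].
have x0 : 0 < x by rewrite -ltcR -Ex normr_gt0.
have y0 : 0 <= y by rewrite -lecR -Ey normr_ge0.
have yx : y <= x by rewrite -lecR -Ex -Ey.
(* With phases P and Q of p and q, scaling by L and conjugating by
   diag(1, L P) gives the phases L P (L P)^* = 1 and L P L Q = 1. *)
pose L := sqrtC (P * Q)^*.
have L2 : L ^+ 2 = (P * Q)^* by rewrite sqrtCK.
have L1 : `|L| = 1.
  apply/eqP; rewrite -(@pexpr_eq1 _ _ 2)// -normrX L2 norm_conjC normrM P1 Q1.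
  by rewrite mulr1.
have w1 : `|L * P| = 1 by rewrite normrM L1 P1 mulr1.
have PP : P * P^* = 1 by rewrite -normCK P1 expr1n.
have QQ : Q * Q^* = 1 by rewrite -normCK Q1 expr1n.
have LL : L * L^* = 1 by rewrite -normCK L1 expr1n.
have xy : 0 < x + y by rewrite ltr_wpDr.
have xy0 : x + y != 0 by rewrite gt_eqF.
(* The factor 2 / (x + y) makes the off-diagonal moduli sum to 2, so they are 1 + beta and 1 - beta
   with beta = (x - y) / (x + y). *)
pose k := 2 / (x + y)%:C%C * L.
have k0 : k != 0.
  rewrite mulf_neq0 ?mulf_neq0 ?invr_eq0 ?pnatr_eq0//.
    by rewrite fmorph_eq0.
  by rewrite -normr_eq0 L1 oner_eq0.
exists (k * t), ((x - y) / (x + y)); split.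
  rewrite divr_ge0 ?subr_ge0 ?(ltW xy)//= ler_pdivrMr// mul1r lerD2l.
  by rewrite -subr_ge0 opprK addr_ge0.
apply: proj_equiv_trans (proj_equiv_scale _ k0) _.
rewrite scale_mx22; apply: proj_equiv_trans (proj_equiv_diag _ _ _ _ w1) _.
suff -> : mx22 (k * t) (k * p * (L * P)^*) (L * P * (k * q)) (k * t) =
   mx1B (k * t) ((x - y) / (x + y)).
  exact: proj_equiv_refl.
have xyC : (x + y)%:C%C != 0 by rewrite fmorph_eq0.
rewrite rmorphD /= in xyC.
congr mx22.
  rewrite Ep Ex /k rmorphM fmorph_div /= rmorphB rmorphD /=.
  transitivity (2 * x%:C%C / (x%:C%C + y%:C%C) * (L * L^*) * (P * P^*)).
    by field.
  by rewrite LL PP; field.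
rewrite Eq Ey /k fmorph_div /= rmorphB rmorphD /=.
transitivity (2 * y%:C%C / (x%:C%C + y%:C%C) * (L ^+ 2) * (P * Q)).
  by field.
rewrite L2 rmorphM /=.
transitivity (2 * y%:C%C / (x%:C%C + y%:C%C) * (P * P^*) * (Q * Q^*)).
  by field.
by rewrite PP QQ; field.
Qed.

Lemma proj_equiv_1B A : (forall t, A != t%:M) ->
  exists alpha beta, 0 <= beta <= 1 /\ proj_equiv A (mx1B alpha beta).
Proof.
move=> nA; have [U Uu [t [p [q E]]]] := constant_diag A.
have AE : proj_equiv A (mx22 t p q t).
  by exists U, 1; rewrite oner_eq0 scale1r.
have tpq : (p != 0) || (q != 0).
  (* If both off-diagonal entries vanish, the conjugate is scalar, hence so is A. *)
  apply/norP => -[/negPn/eqP p0 /negPn/eqP q0]; case/eqP: (nA t).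
  have UU := unitarymx_mulVmx Uu.
  have -> : A = U^t* *m (U *m A *m U^t*) *m U.
    by rewrite !mulmxA UU mul1mx -mulmxA UU mulmx1.
  rewrite E p0 q0 -scalar_mx22.
  by rewrite scalar_mxC -mulmxA UU mulmx1.
wlog qp : p q {E} AE tpq / `|q| <= `|p|.
  move=> W; have [|/ltW] := real_leP (normr_real q) (normr_real p).
    exact: W.
  apply: W; last by rewrite orbC.
  exact: proj_equiv_trans AE (proj_equiv_swap _ _ _ _).
have p0 : p != 0.
  apply: contraTneq tpq => p0; move: qp.
  by rewrite p0 normr0 normr_le0 eqxx => ->.
have [alpha [beta [b01 AB]]] := proj_equiv_1B_of_le t p0 qp.
by exists alpha, beta; split=> //; exact: proj_equiv_trans AE AB.
Qed.

(** Turns the condition on the argument into signs of real and imaginary parts. At least one of z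
    and -z satisfies it, and both do only for z = 0. *)
Lemma arg_lt_pi z : (0 <= arg z < pi) =
  (0 < complex.Im z) || (complex.Im z == 0) && (0 <= complex.Re z).
Proof.
have [->|z0] := eqVneq z 0; first by rewrite arg0 pi_gt0 !lexx eqxx orbT.
have [/andP[a0 a2] ER EI] := argP z0.
set r := Num.sqrt _ in ER EI.
have r0 : 0 < r.
  rewrite sqrtr_gt0; case: z z0 {a0 a2 ER EI r} => a b z0 /=.
  rewrite lt_def addr_ge0 ?sqr_ge0// andbT paddr_eq0 ?sqr_ge0// !sqrf_eq0.
  by move: z0; rewrite eq_complex.
rewrite a0 ER EI pmulr_rgt0// pmulr_rge0// mulf_eq0 (gt_eqF r0) /=.
have [ap|pa] := ltP (arg z) pi.
  move: a0; rewrite le_eqVlt => /predU1P[<-|a0].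
    by rewrite sin0 cos0 eqxx ler01 orbT.
  by rewrite sin_gt0_pi ?a0.
symmetry; apply/norP.
have E : arg z = (arg z - pi) + pi by rewrite subrK.
rewrite E sinDpi cosDpi oppr_gt0 oppr_eq0 oppr_ge0.
move: pa; rewrite le_eqVlt => /predU1P[<-|pa].
  by rewrite subrr sin0 cos0 ltxx eqxx ler10.
have s0 : 0 < sin (arg z - pi).
  by apply: sin_gt0_pi; rewrite subr_gt0 pa ltrBlDr -mulr2n -mulr_natl.
by rewrite ltNge (ltW s0) gt_eqF.
Qed.

Lemma proj_equiv_J1B A : (forall t, A != t%:M) ->
  exists alpha beta, J1B alpha beta /\ proj_equiv A (mx1B alpha beta).
Proof.
move=> /proj_equiv_1B[alpha [beta [b01 AB]]].
have [b1|b1] := eqVneq beta 1.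
  (* For beta = 1 every phase is allowed, and alpha is rotated to its modulus. *)
  have [L L1 EL] := phase_decomposition alpha.
  exists (L^* * alpha), beta; split; last first.
    by apply: proj_equiv_trans AB (proj_equiv_phase _ _ _);
      rewrite ?norm_conjC ?b1 ?eqxx.
  split=> //.
    have LL : L * L^* = 1 by rewrite -normCK L1 expr1n.
    by move=> _; rewrite EL mulrCA [_ * L]mulrC LL mulr1.
  by rewrite b1 ltxx andbF.
(* For beta < 1 only a sign is available; it moves alpha into the half-plane of [arg_lt_pi]. *)
pose L : C := if 0 <= arg alpha < pi then 1 else -1.
exists (L * alpha), beta; split; last first.
  apply: proj_equiv_trans AB (proj_equiv_phase _ _ _); rewrite /L.
    by case: ifP; rewrite ?normrN normr1.
  by case: ifP; rewrite ?sqrrN expr1n.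
split=> // [/eqP|_]; first by rewrite (negPf b1).
rewrite /L; case: ifPn; rewrite ?mul1r// mulN1r !arg_lt_pi.
case: alpha {AB L} => a b /=; rewrite !oppr_gt0 !oppr_eq0 !oppr_ge0.
by case: ltrgt0P => //=; rewrite ?orbT // -ltNge => _ /ltW.
Qed.


(** * Isomorphisms between one-dimensional edge spaces *)

Lemma conj_lrmorphism U : U \is unitarymx ->
  exists f : {lrmorphism 'M[C]_2 -> 'M[C]_2}, forall A, f A = U *m A *m U^t*.
Proof.
move=> Uu; pose g A := U *m A *m U^t*.
have gl : linear g.
  by move=> k A B; rewrite /g mulmxDr mulmxDl -scalemxAr -scalemxAl.
have gm : monoid_morphism g.
  split; first by rewrite /g mulmx1 (unitarymxP Uu).
  move=> A B; rewrite /g -!mulmxE !mulmxA.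
  by rewrite -[_ *m U^t* *m U]mulmxA (unitarymx_mulVmx Uu) mulmx1.
pose Lin := GRing.isLinear.Build C 'M[C]_2 'M[C]_2 *:%R g gl.
pose Mon := GRing.isMonoidMorphism.Build 'M[C]_2 'M[C]_2 g gm.
pose f : {lrmorphism 'M[C]_2 -> 'M[C]_2} := HB.pack g Lin Mon.
by exists f.
Qed.

Lemma vline_scale (V : vectType C) k (v : V) : k != 0 ->
  <[k *: v]>%VS = <[v]>%VS.
Proof.
move=> k0; apply/eqP; rewrite eqEsubv -!memvE memvZ ?memv_line//=.
by apply/vlineP; exists k^-1; rewrite scalerA mulVf ?scale1r.
Qed.

Lemma qgraph_iso_of_proj_equiv A B : proj_equiv A B ->
  qgraph_iso (@tau R) <[A]>%VS <[B]>%VS.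
Proof.
move=> [U [k [Uu k0 E]]]; have [f fE] := conj_lrmorphism Uu.
have UU := unitarymx_mulVmx Uu.
exists f; split.
- split=> [|D]; last by rewrite !fE !adj_mulmx trmxCK !mulmxA.
  exists (fun D => U^t* *m D *m U) => D; rewrite fE.
    by rewrite !mulmxA UU mul1mx -mulmxA UU mulmx1.
  by rewrite !mulmxA (unitarymxP Uu) mul1mx -mulmxA (unitarymxP Uu) mulmx1.
- by move=> D; rewrite fE /tau mxtrace_mulC mulmxA UU mul1mx.
- by rewrite limg_line lfunE /= fE E vline_scale.
Qed.

(** An isomorphism of lines sends a spanning vector to a multiple of the other one, and injectivity
    makes the factor nonzero. *)
Lemma qgraph_iso_lineP A B : A != 0 -> qgraph_iso (@tau R) <[A]>%VS <[B]>%VS ->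
  exists (f : {lrmorphism 'M[C]_2 -> 'M[C]_2}) k,
  [/\ is_star_automorphism f, forall X, \tr (f X) = \tr X,
      k != 0 & f A = k *: B].
Proof.
move=> A0 [f [[fb fs] ft fAB]].
have n2 := two_neq0.
have /vlineP[k fk] : f A \in <[B]>%VS.
  by rewrite -fAB limg_line lfunE memv_line.
exists f, k; split=> // [X|]; first exact: (mulfI n2) (ft X).
apply: contraNneq A0 => k0; apply/eqP; apply: (bij_inj fb).
by rewrite fk k0 scale0r raddf0.
Qed.

(** * Invariants and uniqueness of the parameters *)

Lemma mx1B_neq_scalar (alpha k l : C) (beta : R) : 0 <= beta -> l != 0 ->
  l *: mx1B alpha beta != k%:M.
Proof.
move=> b0 l0; apply/eqP; rewrite scale_mx22 scalar_mx22.
move=> /mx22_inj[_ /eqP+ _ _].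
rewrite mulf_eq0 (negPf l0) -(rmorphD (real_complex R)) fmorph_eq0 /=.
by rewrite gt_eqF// ltr_wpDr.
Qed.

(** The map [f] preserves products, adjoints and the trace, so all three traces may be computed on
    the normal form. *)
Lemma mx1B_invariants A (f : {lrmorphism 'M[C]_2 -> 'M[C]_2}) k alpha
    (beta : R) :
  is_star_automorphism f -> (forall X, \tr (f X) = \tr X) ->
  f A = k *: mx1B alpha beta ->
  [/\ \tr A = 2 * (k * alpha),
      \tr (A *m A) = 2 * k ^+ 2 * (alpha ^+ 2 + 1 - (beta ^+ 2)%:C%C) &
      \tr (A *m A^t*) = 2 * `|k| ^+ 2 * (`|alpha| ^+ 2 + 1 + (beta ^+ 2)%:C%C)].
Proof.
move=> [_ fs] ft fA; split; rewrite -ft.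
- by rewrite fA scale_mx22 trace_mx22; ring.
- have -> : f (A *m A) = f A *m f A by exact: rmorphM.
  by rewrite fA scale_mx22 mul_mx22 trace_mx22 rmorphXn /=; ring.
have -> : f (A *m A^t*) = f A *m f (A^t*) by exact: rmorphM.
rewrite fs fA scale_mx22 adj_mx22 mul_mx22 trace_mx22 !normCK.
rewrite rmorphXn /= !rmorphM.
rewrite rmorphB rmorphD /= rmorph1.
have -> : (beta%:C%C)^* = beta%:C%C by exact: conjc_real.
by ring.
Qed.

Lemma J1B_unique (alpha alpha' L : C) (beta beta' : R) :
    J1B alpha beta -> J1B alpha' beta' -> L != 0 ->
    alpha' = L * alpha ->
    1 - (beta' ^+ 2)%:C%C = L ^+ 2 * (1 - (beta ^+ 2)%:C%C) ->
    1 + (beta' ^+ 2)%:C%C = `|L| ^+ 2 * (1 + (beta ^+ 2)%:C%C) ->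
  (alpha, beta) = (alpha', beta').
Proof.
move=> [/andP[b0 b1] J1 J2] [/andP[b0' b1'] J1' J2'] L0 Ea E1 E2.
(* Both sides of [E1] contain a factor 1 - x^2 >= 0, so taking moduli removes the phase of L^2. *)
have sq x : 0 <= x -> x <= 1 -> `|1 - (x ^+ 2)%:C%C : C| = 1 - (x ^+ 2)%:C%C.
  move=> x0 x1; apply: ger0_norm; rewrite -(rmorph1 (real_complex R)) -rmorphB.
  by rewrite (lecR 0) subr_ge0 expr_le1.
have E3 := congr1 Num.norm E1.
rewrite normrM normrX !sq// in E3.
have L1 : `|L| ^+ 2 = 1.
  have n2 := two_neq0.
  (* Adding the equations for 1 - beta^2 and 1 + beta^2 cancels beta and leaves 2 = 2 |L|^2. *)
  have := mulrDr (`|L| ^+ 2) (1 - (beta ^+ 2)%:C%C) (1 + (beta ^+ 2)%:C%C).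
  rewrite -E3 -E2 [X in _ * X]addrACA [RHS]addrACA !addNr !addr0 => E4.
  by apply: (mulIf n2); rewrite mul1r.
have Eb : beta' = beta.
  apply/eqP; rewrite -(@eqrXn2 _ 2)//; apply/eqP.
  by apply: (fmorph_inj (real_complex R)); move: E2; rewrite L1 mul1r => /addrI.
have nL : `|L| = 1 by apply/eqP; rewrite -(@pexpr_eq1 _ _ 2)// L1.
subst beta'; congr pair.
have [b|b] := eqVneq beta 1.
  have := congr1 Num.norm Ea; rewrite normrM nL mul1r.
  by rewrite !ger0_norm ?J1 ?J1'.
have c1 : 1 - (beta ^+ 2)%:C%C != 0 :> C.
  rewrite -(rmorph1 (real_complex R)) -rmorphB fmorph_eq0 subr_eq0 eq_sym.
  by rewrite pexpr_eq1.
have /eqP : L ^+ 2 = 1 by apply: (mulIf c1); rewrite -E1 mul1r.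
rewrite sqrf_eq1 => /predU1P[LE|/eqP LN].
  by rewrite Ea LE mul1r.
(* For L = -1 both alpha and -alpha lie in the half-plane, which forces alpha = 0. *)
have blt : 0 <= beta < 1 by rewrite b0 lt_neqAle b b1.
move: (J2 blt) (J2' blt); rewrite Ea LN mulN1r !arg_lt_pi.
case: alpha {J1 J2 J1' J2' Ea} => x y /=; rewrite !oppr_gt0 !oppr_eq0 !oppr_ge0.
case: ltrgt0P => //= -> x0 x0'; have -> : x = 0 by apply/le_anti/andP.
by rewrite oppr0.
Qed.

Lemma qgraph_eq_line (S : qgraph R) (x : 'cV[C]_4) :
  pauli_space S = <[x]>%VS -> S = <[pauli_comb x]>%VS.
Proof.
move=> Sx; apply: (bij_inj (@pauli_space_bij R)); rewrite Sx.
apply/vspaceP => y.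
rewrite mem_pauli_space; apply/vlineP/vlineP => -[k].
  by move=> ->; exists k; rewrite linearZ.
by rewrite -linearZ => /(can_inj (@pauli_combK R)) ->; exists k.
Qed.

End Mx22.

(** * Classification of quantum graphs with one edge *)

Theorem theorem5p2 (R : realType)
    (G1A : qgraph R) (G1B : R[i] -> R -> qgraph R)
    (hG1A : pauli_space G1A = V1A R)
    (hG1B : forall (alpha : R[i]) (beta : R), 0 <= beta <= 1 ->
       pauli_space (G1B alpha beta) = V1B alpha beta) :
  G1A = <[(1%:M)%R]>%VS /\
  forall S : qgraph R, num_qedges S = 1%N ->
    (qgraph_iso (@tau R) S G1A /\
     ~ (exists p : R[i] * R,
          J1B p.1 p.2 /\ qgraph_iso (@tau R) S (G1B p.1 p.2))) \/
    (~ qgraph_iso (@tau R) S G1A /\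
     exists! p : R[i] * R,
       J1B p.1 p.2 /\ qgraph_iso (@tau R) S (G1B p.1 p.2)).
Proof.
have G1AE : G1A = <[(1%:M)%R]>%VS.
  rewrite (qgraph_eq_line hG1A); congr (<[_]>%VS).
  rewrite /pauli_comb !big_ord_recl big_ord0 !mxE /= !scale_mx22 scalar_mx22.
  rewrite [LHS]mx22_eta !mxE /=.
  by congr mx22; ring.
have G1BE alpha beta : 0 <= beta <= 1 ->
    G1B alpha beta = <[mx1B alpha beta]>%VS.
  by move=> /hG1B/qgraph_eq_line ->; rewrite pauli_comb_1B.
split=> // S S1.
pose A := vpick S.
have A0 : A != 0 by rewrite vpick0 -dimv_eq0 [X in X == _]S1.
have -> : S = <[A]>%VS.
  apply/esym/eqP; rewrite eqEdim -memvE memv_pick.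
  by rewrite dim_vline A0 [X in (X <= _)%N]S1.
(* The trivial case is that of a scalar spanning vector; automorphisms fix scalars, so the two cases
   exclude each other. *)
have [[t At]|nA] := pselect (exists t, A = t%:M).
  left; split.
    rewrite G1AE; apply: qgraph_iso_of_proj_equiv.
    exists 1%:M, t; split.
    - exact: unitarymx1.
    - by apply: contraNneq A0 => t0; rewrite At t0 raddf0.
    - by rewrite trmx1 map_mx1 mulmx1 mul1mx At scalemx1.
  move=> [[alpha beta] /= [[b01 _ _]]]; rewrite G1BE//.
  move=> /(qgraph_iso_lineP A0)[f [k [_ _ k0 fA]]].
  have /eqP[] := mx1B_neq_scalar alpha t (proj1 (andP b01)) k0.
  by rewrite -fA At -scalemx1 linearZ /= rmorph1.
have {}nA t : A != t%:M by apply/eqP => At; apply: nA; exists t.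
right; split.
  rewrite G1AE => /(qgraph_iso_lineP A0)[f [k [[fb _] _ k0 fA]]].
  have /eqP[] := nA k; apply: (bij_inj fb).
  by rewrite fA -[in RHS]scalemx1 linearZ /= (rmorph1 f).
have [alpha [beta [J AB]]] := proj_equiv_J1B nA.
have [b01 _ _] := J.
have iso : qgraph_iso (@tau R) <[A]>%VS (G1B alpha beta).
  by rewrite G1BE//; exact: qgraph_iso_of_proj_equiv.
exists (alpha, beta); split=> // -[alpha' beta'] /= [J' iso'].
have [b01' _ _] := J'.
move: iso iso'; rewrite !G1BE// => /(qgraph_iso_lineP A0)[f [k [fs ft k0 fA]]].
move=> /(qgraph_iso_lineP A0)[f' [k' [fs' ft' k0' fA']]].
have [I1 I2 I3] := mx1B_invariants fs ft fA.
have [] := mx1B_invariants fs' ft' fA'; rewrite I1 I2 I3.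
have n2 := two_neq0 R.
move=> /(mulfI n2) E1; rewrite -!(mulrA 2) => /(mulfI n2) E2 /(mulfI n2) E3.
have nk0' : `|k'| != 0 by rewrite normr_eq0.
(* The ratio k / k' is the phase relating the two normal forms. *)
have Ea : alpha' = k / k' * alpha by rewrite mulrAC E1 mulrAC mulfV// mul1r.
apply: (J1B_unique (L := k / k')) => //.
- by rewrite mulf_neq0 ?invr_eq0.
(* Subtracting the square of tr A / 2 from tr A^2 / 2 removes alpha and leaves k^2 (1 - beta^2). *)
- have k2 : k' ^+ 2 != 0 by rewrite expf_neq0.
  apply: (mulfI k2).
  have -> : k' ^+ 2 * ((k / k') ^+ 2 * (1 - (beta ^+ 2)%:C%C)) =
     k ^+ 2 * (alpha ^+ 2 + 1 - (beta ^+ 2)%:C%C) - (k * alpha) ^+ 2 by field.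
  by rewrite E2 E1; ring.
(* In the same way, tr A A^* / 2 minus |tr A / 2|^2 equals |k|^2 (1 + beta^2). *)
have k2 : `|k'| ^+ 2 != 0 by rewrite expf_neq0.
apply: (mulfI k2); rewrite normf_div.
have -> : `|k'| ^+ 2 * ((`|k| / `|k'|) ^+ 2 * (1 + (beta ^+ 2)%:C%C)) =
   `|k| ^+ 2 * (`|alpha| ^+ 2 + 1 + (beta ^+ 2)%:C%C) - (`|k| * `|alpha|) ^+ 2.
  by field.
by rewrite -normrM E3 E1 normrM; ring.
Qed.
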